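(* Let $\Sigma=\{0,1\}$ and let $P\subseteq\Sigma^*\setminus\{\epsilon\}$ be finite and prefix-free. An accepting state of the product automaton $\mathcal M_P$ is reachable (from its initial state) if and only if there exist a length $n$, two distinct codewords $c_1,c_2\in C_n(P)$, and a word $z\in\Sigma^n$ such that $z\in B(c_1)\cap B(c_2)$. Consequently, $C_n(P)$ is correcting for every $n\ge0$ if and only if no accepting state of $\mathcal M_P$ is reachable.
   Context: Prefix-free means no word of $P$ is a proper prefix of another word of $P$. $P^*$ is the set of all finite concatenations (including the empty word $\epsilon$) of words of $P$, and $C_n(P)=P^*\cap\Sigma^n$. For $c\in\Sigma^n$, $B(c)$ is the set of words $z_1\cdots z_n$ with $z_i=c_{\pi(i)}$ for a permutation $\pi$ of $\{1,\dots,n\}$ with $|\pi(i)-i|\le1$ for all $i$ (equivalently, words obtained by swapping any set of pairwise disjoint adjacent pairs of positions). A code $C\subseteq\Sigma^n$ is correcting if $B(c)\cap B(c')=\emptyset$ for all distinct $c,c'\in C$. Trie automaton $\mathcal A_P=(V,\delta,r_0)$: $V$ is the set of all proper prefixes of words of $P$, including $\epsilon$; $r_0=\epsilon$; $\delta:V\times\Sigma\to V$ is partial: $\delta(v,b)=vb$ if $vb$ is a proper prefix of a word of $P$; $\delta(v,b)=r_0$ if $vb\in P$; undefined otherwise. Parser: micro-states are pairs $(v,p)$ with $v\in V$, $p\in\{\circ,H_0,H_1\}$. On reading $\beta\in\Sigma$, the legal moves are: copy, from $(v,\circ)$ to $(\delta(v,\beta),\circ)$, emitting $\beta$, provided $\delta(v,\beta)$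 is defined; swap-start, from $(v,\circ)$ to $(v,H_\beta)$, emitting $\epsilon$; swap-resolve, from $(v,H_h)$ to $(\delta(\delta(v,\beta),h),\circ)$, emitting $\beta h$, provided both transitions are defined. Product automaton $\mathcal M_P$: states are tuples $(v_1,p_1,v_2,p_2,\mathrm{div},\mathrm{lead})$ with $v_1,v_2\in V$, $p_1,p_2\in\{\circ,H_0,H_1\}$, $\mathrm{div}\in\{\bot,\top\}$, $\mathrm{lead}\in\{\circ,L_1(0),L_1(1),L_2(0),L_2(1)\}$. The initial state is $(r_0,\circ,r_0,\circ,\bot,\circ)$. Transitions on $\beta\in\Sigma$: for $i=1,2$ choose a legal parser move on $\beta$ from $(v_i,p_i)$ to $(v_i',p_i')$ emitting $\eta_i$. Put $\xi_1=\eta_1,\ \xi_2=\eta_2$ if $\mathrm{lead}=\circ$; $\xi_1=a\eta_1,\ \xi_2=\eta_2$ if $\mathrm{lead}=L_1(a)$; $\xi_1=\eta_1,\ \xi_2=a\eta_2$ if $\mathrm{lead}=L_2(a)$. Compare $\xi_1$ and $\xi_2$ symbol by symbol from the left for as long as both have a symbol available; set $\mathrm{div}'=\top$ if some compared pair is unequal, otherwise $\mathrm{div}'=\mathrm{div}$. Delete the compared symbols from both words; on reachable states at most one symbol remains in total. Set $\mathrm{lead}'=\circ$ if none remains, $\mathrm{lead}'=L_i(a)$ if one symbol $a$ remains on side $i$. The new state is $(v_1',p_1',v_2',p_2',\mathrm{div}',\mathrm{lead}')$. A state is accepting if $v_1=v_2=r_0$, $p_1=p_2=\circ$, $\mathrm{lead}=\circ$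 and $\mathrm{div}=\top$. *)

(* Defs.v *)
From HB Require Import structures.
From mathcomp Require Import all_boot all_fingroup all_algebra finmap.
From Stdlib Require Import Relations.

Set Implicit Arguments.
Unset Strict Implicit.
Unset Printing Implicit Defensive.

(* The alphabet is bool, with false = 0 and true = 1. *)

Definition word := seq bool.

Definition proper_prefix (u w : word) : bool := prefix u w && (u != w).

Definition prefix_free (P : {fset word}) : Prop :=
  forall u w, u \in P -> w \in P -> ~~ proper_prefix u w.

Definition star (P : {fset word}) (c : word) : Prop :=
  exists ws : seq word, {subset ws <= P} /\ c = flatten ws.

Definition code (P : {fset word}) (n : nat) (c : n.-tuple bool) : Prop :=
  star P c.

Definition ball (n : nat) (c : n.-tuple bool) : {set n.-tuple bool} :=
  [set z : n.-tuple bool | [exists pi : 'S_n,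
     [forall i : 'I_n, `|pi i - i|%N <= 1] &&
     [forall i : 'I_n, tnth z i == tnth c (pi i)]]].

Definition correcting (n : nat) (C : n.-tuple bool -> Prop) : Prop :=
  forall c c' : n.-tuple bool, C c -> C c' -> c <> c' ->
    ball c :&: ball c' = set0.

(* The disjunct v = [::] only matters when P is empty. *)
Definition is_vertex (P : {fset word}) (v : word) : bool :=
  (v == [::]) || has (proper_prefix v) (enum_fset P).

Definition vertex (P : {fset word}) := {v : word | is_vertex P v}.

Definition r0 (P : {fset word}) : vertex P := exist _ [::] isT.

(* As rcons v b is nonempty, insub (rcons v b) is defined exactly when it is a
   proper prefix of a word of P. *)
Definition delta (P : {fset word}) (v : vertex P) (b : bool) :
    option (vertex P) :=
  let vb := rcons (val v) b in
  if insub vb is Some v' then Some v'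
  else if vb \in P then Some (r0 P) else None.

Inductive phase := Idle | Hold of bool.

(* parser_move b m m' eta: on reading b, the parser may go from m to m',
   emitting eta. *)
Inductive parser_move (P : {fset word}) (b : bool) :
    vertex P * phase -> vertex P * phase -> word -> Prop :=
| Copy v v' : delta v b = Some v' ->
    parser_move b (v, Idle) (v', Idle) [:: b]
| SwapStart v :
    parser_move b (v, Idle) (v, Hold b) [::]
| SwapResolve v u v' h : delta v b = Some u -> delta u h = Some v' ->
    parser_move b (v, Hold h) (v', Idle) [:: b; h].

Inductive lead := NoLead | Lead1 of bool | Lead2 of bool.

(* The pending symbols on sides 1 and 2. *)
Definition pending (l : lead) : word * word :=
  match l with
  | NoLead => ([::], [::])
  | Lead1 a => ([:: a], [::])
  | Lead2 a => ([::], [:: a])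
  end.

Record pstate (P : {fset word}) := PState {
  vtx1 : vertex P;
  phase1 : phase;
  vtx2 : vertex P;
  phase2 : phase;
  diverged : bool;
  leading : lead
}.

Definition init (P : {fset word}) : pstate P :=
  PState (r0 P) Idle (r0 P) Idle false NoLead.

Definition mismatch (x1 x2 : word) : bool :=
  has (fun p => p.1 != p.2) (zip x1 x2).

Definition residue (x1 x2 : word) : word * word :=
  (drop (size x2) x1, drop (size x1) x2).

(* The last clause determines the new lead; it is unsatisfiable only if more
   than one symbol remains, which never happens from a reachable state
   (reachable_residue below). *)
Definition step (P : {fset word}) (b : bool) (s s' : pstate P) : Prop :=
  exists eta1 eta2 : word,
    let xi1 := (pending (leading s)).1 ++ eta1 in
    let xi2 := (pending (leading s)).2 ++ eta2 in
    [/\ parser_move b (vtx1 s, phase1 s) (vtx1 s', phase1 s') eta1,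
        parser_move b (vtx2 s, phase2 s) (vtx2 s', phase2 s') eta2,
        diverged s' = diverged s || mismatch xi1 xi2
      & residue xi1 xi2 = pending (leading s')].

Definition reachable (P : {fset word}) (s : pstate P) : Prop :=
  clos_refl_trans _ (fun s1 s2 => exists b, step b s1 s2) (init P) s.

Definition accepting (P : {fset word}) (s : pstate P) : Prop :=
  [/\ vtx1 s = r0 P /\ vtx2 s = r0 P,
      phase1 s = Idle /\ phase2 s = Idle,
      leading s = NoLead
    & diverged s = true].

Definition held (p : phase) : nat := if p is Hold _ then 1 else 0.

Lemma reachable_balanced (P : {fset word}) (s : pstate P) : reachable s ->
  size (pending (leading s)).1 + held (phase1 s) =
  size (pending (leading s)).2 + held (phase2 s).
Proof.
move=> /(@clos_rt_rtn1 _ _ _ _) hs.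
elim: {s} hs => [//|s1 s2 [b [e1 [e2 /= [m1 m2 _ hr]]]] _].
have [] := (congr1 (size \o fst) hr, congr1 (size \o snd) hr).
rewrite /= !size_drop !size_cat.
by inversion m1; inversion m2; case: (leading s1) => [|a|a];
  case: (leading s2).
Qed.

Lemma reachable_residue (P : {fset word}) (s : pstate P) (b : bool)
    (m1 m2 : vertex P * phase) (eta1 eta2 : word) : reachable s ->
  parser_move b (vtx1 s, phase1 s) m1 eta1 ->
  parser_move b (vtx2 s, phase2 s) m2 eta2 ->
  exists l, residue ((pending (leading s)).1 ++ eta1)
                    ((pending (leading s)).2 ++ eta2) = pending l.
Proof.
move=> /reachable_balanced hs h1 h2; move: hs.
inversion h1; inversion h2; case: (leading s) => [|a|a] //= _;
  rewrite /residue /=;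
  solve [by exists NoLead | by eexists (Lead1 _) | by eexists (Lead2 _)].
Qed.

(* Main.v *)
Require Import Defs.
From mathcomp Require Import all_boot all_fingroup all_algebra finmap.
From mathcomp Require Import zify.
From Stdlib Require Import Relations.

(** A permutation moving every position by at most one is a product of
    disjoint adjacent transpositions, so that z lies in the ball of c exactly
    when some run of the parser reads z and emits c; prefix-freeness makes the
    deterministic trie walk along c return to its root exactly when c is a
    concatenation of words of P.  A run of the product automaton is a pair of
    parser runs on a common input, in which the lead stores the uncompared part
    of the two outputs and div records whether the compared parts differ. *)

Set Implicit Arguments.
Unset Strict Implicit.
Unset Printing Implicit Defensive.

(** * Disjoint adjacent swaps and the ball of a word *)

(** Built at the right end, where parser runs grow: the constructors mirror a copy move and a
    swap-start followed by its swap-resolve. *)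
Inductive swapped : word -> word -> Prop :=
| SwappedNil : swapped [::] [::]
| SwappedCopy c z a : swapped c z -> swapped (rcons c a) (rcons z a)
| SwappedSwap c z a b : swapped c z ->
    swapped (rcons (rcons c b) a) (rcons (rcons z a) b).

Lemma size_swapped c z : swapped c z -> size c = size z.
Proof. by elim=> {c z} [//|c z a _|c z a b _]; rewrite !size_rcons => ->. Qed.

(** The map lives on all of [nat] and is the identity beyond the word, so each constructor only
    alters it at the new positions. *)
Lemma swapped_involution c z : swapped c z ->
  exists f : nat -> nat,
    [/\ involutive f, forall i, f i <= i.+1 /\ i <= (f i).+1,
        forall i, size z <= i -> f i = i
      & forall i, nth false z i = nth false c (f i)].
Proof.
elim=> {c z} [|c z a sw [f [fK f1 fge fnth]]|c z a b sw [f [fK f1 fge fnth]]].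
- by exists id; split=> // i; rewrite !nth_nil.
- exists f; split=> // i.
    by rewrite size_rcons => /ltnW /fge.
  rewrite !nth_rcons (size_swapped sw) -fnth.
  have := fK i; have := fge i; have := fge (f i).
  by case: (ltngtP i (size z)) => hi; case: (ltngtP (f i) (size z)) => hf //; lia.
have sz := size_swapped sw.
(* If [f i] lay beyond the word it would be fixed, and applying [f] again would give [i = f i]. *)
have flt i : i < size z -> f i < size z.
  by move=> hi; have := fK i; have := fge (f i); lia.
exists (fun i => if i == size z then (size z).+1 else
                 if i == (size z).+1 then size z else f i).
split.
- move=> i; have := fK i; have := fge i; have := flt i.
  case: (i =P size z) => [->|h1]; first by rewrite eqxx; case: eqP; lia.
  case: (i =P (size z).+1) => [->|h2]; first by rewrite eqxx.
  by case: (f i =P _); [lia|case: (f i =P _); lia].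
- by move=> i; have := f1 i; case: (i =P size z); case: (i =P (size z).+1); lia.
- by move=> i; rewrite !size_rcons => h; rewrite fge; case: (i =P size z); case: (i =P (size z).+1); lia.
move=> i; case: (i =P size z) => [->|h1].
  by rewrite !nth_rcons !size_rcons !sz ltnSn !ltnn !eqxx.
case: (i =P (size z).+1) => [->|h2].
  by rewrite !nth_rcons !size_rcons !sz ltnSn !ltnn !eqxx.
have [hi|hi] := ltnP i (size z).
  by rewrite !nth_rcons !size_rcons !sz fnth !ltnS (ltnW hi) hi flt // ltnW // flt.
by rewrite fge // !nth_default // !size_rcons ?sz; lia.
Qed.

(** Induction on the length, peeling off the last position if it is fixed and the last two if they
    are exchanged. All hypotheses are bounded by [size z], so the same [f] and [g] serve the shorter
    words. *)
Lemma swapped_bijection (f g : nat -> nat) (c z : word) :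
    size c = size z ->
    (forall i, i < size z -> f i < size z /\ g i < size z) ->
    (forall i, i < size z -> f (g i) = i /\ g (f i) = i) ->
    (forall i, i < size z -> f i <= i.+1 /\ i <= (f i).+1) ->
    (forall i, i < size z -> nth false z i = nth false c (f i)) ->
  swapped c z.
Proof.
have [n] := ubnP (size z); elim: n c z => // n IH c z.
case/lastP: z => [|z a]; first by case: c => // *; exact: SwappedNil.
case/lastP: c => [|c b]; first by rewrite size_rcons.
rewrite !size_rcons ltnS => ltn [sz] fg fgK f1 fnth.
have := fnth (size z) (ltnSn _); have [fgl _] := fg (size z) (ltnSn _).
have [_ fl1] := f1 (size z) (ltnSn _).
rewrite !nth_rcons ltnn eqxx sz.
(* [z] has lost its final letter, so [size z] is the last position; its image is in range and at
   distance at most one. *)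
have [fl|fl] : f (size z) = size z \/ (f (size z)).+1 = size z by lia.
  have gl : g (size z) = size z by have [_] := fgK _ (ltnSn (size z)); rewrite fl.
  rewrite fl ltnn eqxx => ->; apply: SwappedCopy; apply: IH => // i hi.
  - have := fg i; have := fgK i => fi fgi.
    have: f i <> size z by move=> h; rewrite h in fi; lia.
    have: g i <> size z by move=> h; rewrite h in fi; lia.
    lia.
  - by apply: fgK; lia.
  - by apply: f1; lia.
  have := fnth i; have := fg i; have := fgK i => fi fgi.
  have h0 : f i <> size z by move=> h; rewrite h in fi; lia.
  rewrite !nth_rcons sz.
  have [-> ->] : i < size z /\ f i < size z by split; lia.
  by apply; lia.
(* The preimage of the last position is not itself, so it is the one before. *)
have fl' : f (size z).-1 = size z.
  have [fgz _] := fgK (size z) (ltnSn _); have [_ gz] := fg (size z) (ltnSn _).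
  have [] := f1 (g (size z)); rewrite ?fgz // => gz1 _.
  have: g (size z) <> size z by move=> e; rewrite e in fgz; lia.
  by move=> ?; have <- : g (size z) = (size z).-1 by lia.
case/lastP: z => [|z d] in ltn sz fg fgK f1 fnth fgl fl1 fl fl' *; first by [].
case/lastP: c => [|c e] in sz fnth *; first by rewrite size_rcons in sz.
have := fnth (size z); rewrite !size_rcons in ltn sz fg fgK f1 fnth fl fl' fgl fl1 *.
case: sz => sz; case: fl => fl; rewrite /= in fl'.
rewrite fl' fl !nth_rcons !size_rcons !sz ltnS leqnn !ltnn !eqxx.
move=> /(_ (ltnW (ltnSn _))) -> ->; apply: SwappedSwap.
have fgK0 := fgK (size z); have fgK1 := fgK (size z).+1.
rewrite fl' fl in fgK0 fgK1.
(* Both maps exchange the two last positions, hence preserve the set of earlier ones. *)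
apply: IH => // [|i hi|i hi|i hi|i hi]; first by lia.
- have := fg i; have := fgK i => fi fgi.
  have: f i <> size z by move=> h; rewrite h in fi; lia.
  have: f i <> (size z).+1 by move=> h; rewrite h in fi; lia.
  have: g i <> size z by move=> h; rewrite h in fi; lia.
  have: g i <> (size z).+1 by move=> h; rewrite h in fi; lia.
  lia.
- by apply: fgK; lia.
- by apply: f1; lia.
have := fnth i; have := fg i; have := fgK i => fi fgi.
have h0 : f i <> size z by move=> h; rewrite h in fi; lia.
have h1 : f i <> (size z).+1 by move=> h; rewrite h in fi; lia.
rewrite !nth_rcons !size_rcons !sz.
have [-> -> -> ->] : [/\ i < size z, i < (size z).+1, f i < size z & f i < (size z).+1].
  by split; lia.
by apply; lia.
Qed.

Lemma ballP n (c z : n.-tuple bool) : reflect (swapped c z) (z \in ball c).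
Proof.
rewrite inE; apply: (iffP existsP) => [[pi /andP[/forallP p1 /forallP pn]]|sw].
  (* Length zero is separate because [inord] needs a nonempty ordinal type. *)
  case: n c z pi p1 pn => [|n] c z pi p1 pn.
    by rewrite (tuple0 c) (tuple0 z); exact: SwappedNil.
  apply: (@swapped_bijection (fun i => pi (inord i)) (fun i => (pi^-1)%g (inord i)));
    rewrite !size_tuple //.
  - by move=> i hi; rewrite !inord_val permK permKV !inordK.
  - by move=> i hi; have := p1 (inord i); rewrite inordK //; lia.
  move=> i hi; have := eqP (pn (inord i)).
  by rewrite !(tnth_nth false) inordK.
have [f [fK f1 fge fnth]] := swapped_involution sw.
have flt (i : 'I_n) : f i < n.
  by have := fK i; have := fge (f i); rewrite size_tuple; have := ltn_ord i; lia.
have inj : injective (fun i => Ordinal (flt i)).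
  by move=> i j /(congr1 val) /= /(can_inj fK) /val_inj.
exists (perm inj); apply/andP; split; apply/forallP => i; rewrite permE /=.
  by have := f1 i; lia.
by rewrite !(tnth_nth false) /= fnth.
Qed.

(** * Walks in the trie and membership in the star *)

Section Trie.

Variable P : {fset word}.

Definition walk (v : vertex P) (c : word) : option (vertex P) :=
  foldl (fun o b => obind (fun u => delta u b) o) (Some v) c.

Lemma walk_rcons v c b : walk v (rcons c b) = obind (fun u => delta u b) (walk v c).
Proof. by rewrite /walk foldl_rcons. Qed.

Lemma walk_cat v u c d : walk v c = Some u -> walk v (c ++ d) = walk u d.
Proof. by rewrite /walk foldl_cat => ->. Qed.

Lemma deltaP v b v' : @delta P v b = Some v' ->
  val v' = rcons (val v) b \/ v' = r0 P /\ rcons (val v) b \in P.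
Proof.
rewrite /delta; case: insubP => [u _ <- [->]|_]; first by left.
by case: ifP => // ? [<-]; right.
Qed.

(** Each return to the root completes a word of [P]; the current vertex is the unfinished
    remainder. *)
Lemma walk_flatten c v : walk (r0 P) c = Some v ->
  exists ws : seq word, {subset ws <= P} /\ c = flatten ws ++ val v.
Proof.
elim/last_ind: c v => [|c b IH] v; first by case=> <-; exists [::].
rewrite walk_rcons; case: (walk _ c) IH => //= u /(_ u erefl) [ws [wsP ->]].
case/deltaP => [->|[-> uP]]; first by exists ws; rewrite rcons_cat.
exists (rcons ws (rcons (val u) b)); split.
  by move=> w; rewrite mem_rcons inE => /predU1P [->|/wsP].
by rewrite flatten_rcons cats0 rcons_cat.
Qed.

Lemma proper_prefix_cat u b w : proper_prefix u (u ++ b :: w).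
Proof.
rewrite /proper_prefix prefix_prefix -[X in X != _]cats0.
by rewrite eqseq_cat // eqxx.
Qed.

Lemma is_vertex_rcons u b : is_vertex P (rcons u b) -> is_vertex P u.
Proof.
rewrite /is_vertex; case/orP; first by case: u.
case/hasP=> w wP /andP[/prefixP[t e] _]; apply/orP; right; apply/hasP.
by exists w => //; rewrite e cat_rcons proper_prefix_cat.
Qed.

Lemma walk_vertex v : walk (r0 P) (val v) = Some v.
Proof.
case: v => /= u; elim/last_ind: u => [|u b IH] hu.
  by congr Some; exact: val_inj.
rewrite walk_rcons (IH (is_vertex_rcons hu)) /= /delta.
by case: insubP => [v _ e|]; [congr Some; exact: val_inj|rewrite hu].
Qed.

Hypotheses (P0 : [::] \notin P) (pfP : prefix_free P).

(** Prefix-freeness enters here: [delta] tries to extend the vertex first, so the last letter leads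
    to the root only because [w] is not a proper prefix of another word. *)
Lemma walk_word w : w \in P -> walk (r0 P) w = Some (r0 P).
Proof.
case/lastP: w => [/(negP P0)//|u b wP].
have hu : is_vertex P u.
  apply/orP; right; apply/hasP; exists (rcons u b) => //.
  by rewrite -cats1 proper_prefix_cat.
rewrite walk_rcons (walk_vertex (exist _ u hu)) /= /delta /=.
case: insubP => [v|_]; last by rewrite wP.
case/orP; first by case: (u).
by case/hasP=> w wP' h; move: (pfP wP wP'); rewrite h.
Qed.

Lemma starP c : star P c <-> walk (r0 P) c = Some (r0 P).
Proof.
split=> [[ws [wsP ->]]|/walk_flatten [ws [wsP ->]]]; last first.
  by exists ws; rewrite cats0.
elim: ws wsP => //= w ws IH wsP.
rewrite (walk_cat _ (walk_word (wsP _ (mem_head _ _)))); apply: IH => u hu.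
by apply: wsP; rewrite inE hu orbT.
Qed.

End Trie.

(** * Parser runs *)

Section Runs.

Variable P : {fset word}.

Inductive parses : word -> word -> vertex P * phase -> Prop :=
| ParsesNil : parses [::] [::] (r0 P, Idle)
| ParsesStep z b c m m' eta : parses z c m -> parser_move b m m' eta ->
    parses (rcons z b) (c ++ eta) m'.

Lemma parses_nil c m : parses [::] c m -> c = [::] /\ m = (r0 P, Idle).
Proof.
move E : [::] => z h; case: h E => // z0 b c1 m1 m' eta _ _ /(congr1 size).
by rewrite size_rcons.
Qed.

Lemma parses_rcons z b c' m' : parses (rcons z b) c' m' ->
  exists c m eta, [/\ parses z c m, parser_move b m m' eta & c' = c ++ eta].
Proof.
move E : (rcons z b) => z' h; case: h E => [/(congr1 size)|z0 b0 c m m1 eta h1 h2].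
  by rewrite size_rcons.
by case/rcons_inj=> -> ->; exists c, m, eta.
Qed.

(** The invariant must cover the holding phase: the held letter is the last one read and is not yet
    emitted, so the output corresponds to the input without it. *)
Lemma parses_sound z c m : parses z c m ->
  walk (r0 P) c = Some m.1 /\
  if m.2 is Hold h then exists2 z', z = rcons z' h & swapped c z'
  else swapped c z.
Proof.
elim=> {z c m} [|z b c m m' eta _]; first by split=> //; exact: SwappedNil.
move=> IH mv; case: mv IH => [v v' d|v|v u v' h d1 d2] /= [w IH].
- rewrite cats1 walk_rcons w; split=> //; exact: SwappedCopy.
- by rewrite cats0; split=> //; exists z.
case: IH => z' -> sw; rewrite -cat_rcons cats1 !walk_rcons w /= d1 /= d2.
by split=> //; exact: SwappedSwap.
Qed.

Lemma parses_complete c z v : swapped c z -> walk (r0 P) c = Some v ->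
  parses z c (v, Idle).
Proof.
move=> sw; elim: sw v => {c z} [|c z a _ IH|c z a b _ IH] v.
- by case=> <-; exact: ParsesNil.
- rewrite walk_rcons; case: (walk _ c) IH => //= u /(_ u erefl) h d.
  by rewrite -[rcons c a]cats1; apply: ParsesStep h _; exact: Copy.
rewrite !walk_rcons; case: (walk _ c) IH => //= u /(_ u erefl) h.
case d1 : (delta u b) => [t|//] /= d2; rewrite -[rcons (rcons c b) a]cats1 cat_rcons.
(* The input ends in [a], [b]: the parser stores [a], then on reading [b] emits [b], [a]. *)
apply: (ParsesStep (m := (u, Hold a))); last exact: SwapResolve d1 d2.
by rewrite -[c]cats0; apply: ParsesStep h _; exact: SwapStart.
Qed.

Lemma parsesP c z v : parses z c (v, Idle) <-> swapped c z /\ walk (r0 P) c = Some v.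
Proof.
by split=> [/parses_sound[]|[]]; [|exact: parses_complete].
Qed.

(** * Comparison of two outputs and the product automaton *)

(** Comparing block by block, carrying over only the uncompared part, agrees with comparing the
    whole words; this and [mismatch_cat] turn the local rule of [step] into a global one. *)
Lemma residue_cat (x1 x2 y1 y2 : word) :
  residue (x1 ++ y1) (x2 ++ y2) =
  residue ((residue x1 x2).1 ++ y1) ((residue x1 x2).2 ++ y2).
Proof.
rewrite /residue; elim: x1 x2 => [|a x1 IH] [|b x2] //=.
Qed.

Lemma mismatch_cat (x1 x2 y1 y2 : word) :
  mismatch (x1 ++ y1) (x2 ++ y2) =
  mismatch x1 x2 || mismatch ((residue x1 x2).1 ++ y1) ((residue x1 x2).2 ++ y2).
Proof.
rewrite /mismatch /residue; elim: x1 x2 => [|a x1 IH] [|b x2] //=.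
by rewrite IH orbA.
Qed.

Lemma mismatchP (x1 x2 : word) : size x1 = size x2 -> mismatch x1 x2 = (x1 != x2).
Proof.
rewrite /mismatch; elim: x1 x2 => [|a x1 IH] [|b x2] //= [/IH ->].
by rewrite eqseq_cons negb_and.
Qed.

Definition traces (s : pstate P) (z c1 c2 : word) : Prop :=
  [/\ parses z c1 (vtx1 s, phase1 s), parses z c2 (vtx2 s, phase2 s),
      pending (leading s) = residue c1 c2 & diverged s = mismatch c1 c2].

Lemma reachable_traces s : reachable s -> exists z c1 c2, traces s z c1 c2.
Proof.
move=> /(@clos_rt_rtn1 _ _ _ _) hs; elim: {s} hs.
  by exists [::], [::], [::]; split=> //; exact: ParsesNil.
move=> s s' [b [e1 [e2 /= [mv1 mv2 dv rs]]]] _ [z [c1 [c2 [p1 p2 ld dv0]]]].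
exists (rcons z b), (c1 ++ e1), (c2 ++ e2); split.
- exact: ParsesStep p1 mv1.
- exact: ParsesStep p2 mv2.
- by rewrite residue_cat -ld.
by rewrite mismatch_cat -ld -dv0.
Qed.

(** The runs share their input and so advance together. Reachability is carried through the
    induction because it ensures, by [reachable_residue], that the next lead exists. *)
Lemma traces_reachable z c1 c2 m1 m2 : parses z c1 m1 -> parses z c2 m2 ->
  exists l, let s := PState m1.1 m1.2 m2.1 m2.2 (mismatch c1 c2) l in
    reachable s /\ pending l = residue c1 c2.
Proof.
elim/last_ind: z c1 c2 m1 m2 => [|z b IH] c1 c2 m1 m2.
  move=> /parses_nil[-> ->] /parses_nil[-> ->]; exists NoLead; split=> //.
  exact: rt_refl.
move=> /parses_rcons[d1 [[v1 q1] [e1 [p1 mv1 ->]]]].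
move=> /parses_rcons[d2 [[v2 q2] [e2 [p2 mv2 ->]]]].
have [l0 [/= hs ld]] := IH _ _ _ _ p1 p2.
have [l hl] := reachable_residue hs mv1 mv2.
exists l; rewrite /= residue_cat -ld hl; split=> //.
apply: rt_trans hs _; apply: rt_step; exists b, e1, e2; split=> //=.
- by case: (m1) mv1.
- by case: (m2) mv2.
by rewrite mismatch_cat -ld.
Qed.

End Runs.

Theorem theorem13 (P : {fset word}) (P_nonempty_words : [::] \notin P)
    (P_prefix_free : prefix_free P) :
  ((exists s : pstate P, reachable s /\ accepting s) <->
   (exists (n : nat) (c1 c2 z : n.-tuple bool),
      [/\ code P c1, code P c2, c1 <> c2 & z \in ball c1 :&: ball c2]))
  /\
  ((forall n : nat, correcting (@code P n)) <->
   ~ (exists s : pstate P, reachable s /\ accepting s)).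
Proof.
have st := starP P_nonempty_words P_prefix_free.
have main : (exists s : pstate P, reachable s /\ accepting s) <->
   (exists (n : nat) (c1 c2 z : n.-tuple bool),
      [/\ code P c1, code P c2, c1 <> c2 & z \in ball c1 :&: ball c2]).
  split=> [[s [/reachable_traces[z [c1 [c2 [p1 p2 _ dv]]]]]]|].
    case=> [[e1 e2] [f1 f2] _ dv1]; rewrite e1 f1 in p1; rewrite e2 f2 in p2.
    have [[sw1 w1] [sw2 w2]] := ((parsesP _ _ _).1 p1, (parsesP _ _ _).1 p2).
    have [s1 s2] := (size_swapped sw1, size_swapped sw2).
    (* In an idle state each output is as long as the input, which gives the common length [n]. *)
    have [/eqP t1 /eqP t2] := (s1, s2).
    exists (size z), (Tuple t1), (Tuple t2), (in_tuple z); split.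
    - exact/st.
    - exact/st.
    - move/(congr1 val) => /= e.
      by move: dv; rewrite dv1 mismatchP ?s1 // e eqxx.
    by rewrite inE; apply/andP; split; apply/ballP.
  case=> n [c1 [c2 [z [/st w1 /st w2 ne]]]].
  rewrite inE => /andP[/ballP sw1 /ballP sw2].
  have /= [l [hs ld]] := traces_reachable (parses_complete sw1 w1)
    (parses_complete sw2 w2).
  exists (PState (r0 P) Idle (r0 P) Idle (mismatch c1 c2) l); split=> //.
  split=> //=.
    (* Outputs of equal length are compared completely, so nothing is pending. *)
    by move: ld; rewrite /residue !size_tuple !drop_oversize ?size_tuple //; case: l hs.
  by rewrite mismatchP ?size_tuple //; apply/eqP => /val_inj.
split=> //; split=> [cor /main[n [c1 [c2 [z [h1 h2 ne]]]]]|acc n c1 c2 h1 h2 ne].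
  by rewrite (cor n _ _ h1 h2 ne) inE.
case: (set_0Vmem (ball c1 :&: ball c2)) => // -[z hz].
by case: acc; apply/main; exists n, c1, c2, z.
Qed.
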